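(* Let $\kappa<0$ and $\bar\kappa:=\frac{-9-5\sqrt5+\sqrt{190+90\sqrt5}}{4}\approx-0.1001$, and define $(\gamma L)^*(\kappa)$ as the unique solution belonging to the interval $[1,2)$ of the equation (in the unknown $\gamma L$) $$-\kappa(1+\kappa)(\gamma L)^3+\big[3\kappa+(1+\kappa)^2\big](\gamma L)^2-4(1+\kappa)(\gamma L)+4=0.$$ With respect to minimizing the tight performance bound $\frac{f(x_0)-f_*}{D_N(\gamma L)}$ for weakly convex functions (given in the context), $(\gamma L)^*(\kappa)$ is: 1. the optimal constant (normalized) stepsize for any $N$, when $\kappa\le\bar\kappa$; 2. the asymptotically optimal constant (normalized) stepsize as $N\to\infty$, i.e., when the algorithm runs for a sufficiently large number of iterations, if $\kappa\in(\bar\kappa,0)$.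
   Context: Let $L>0$, $\mu<0$, $\kappa=\mu/L$, and let $f:\mathbb{R}^d\to\mathbb{R}$ be bounded below, with $f_*=\inf_x f(x)$, and such that $\frac L2\|\cdot\|^2-f$ and $f-\frac\mu2\|\cdot\|^2$ are convex. Consider $N$ iterations $x_{i+1}=x_i-\gamma\nabla f(x_i)$ of gradient descent from $x_0$ with constant stepsize $\gamma$, $\gamma L\in(0,2)$. The performance bound is $$\frac1{2L}\min_{0\le i\le N}\|\nabla f(x_i)\|^2\le\frac{f(x_0)-f_*}{D_N(\gamma L)},\qquad D_N(\gamma L):=1+\gamma L\,\min\Big\{P_N(\gamma L,\gamma\mu),\ \frac{-1+(1-\gamma L)^{-2N}}{\gamma L}\Big\},$$ where, for $l\in(0,2)$ and $u<0$, $$P_N(l,u):=p(l,u)\bigg[N-\frac{-lu}{l-u}\sum_{k=1}^N\Big[\frac{-1+(1-u)^{-2k}}{u}-\frac{-1+(1-l)^{-2k}}{l}\Big]_+\bigg],\qquad p(l,u):=2-\frac{-lu}{1-u-|1-l|},$$ with $[x]_+:=\max\{x,0\}$. For $l\in(0,1]$ every term $[\cdot]_+$ in the sum is zero; at $l=1$, $(1-l)^{-2k}$ is read as $+\infty$. *)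

(* Defs.v *)
From HB Require Import structures.
From mathcomp Require Import all_boot all_order all_algebra.
From mathcomp Require Import all_classical all_reals all_analysis.

Set Implicit Arguments.
Unset Strict Implicit.
Unset Printing Implicit Defensive.

Import Order.TTheory GRing.Theory Num.Theory.
Import numFieldNormedType.Exports.

Local Open Scope classical_set_scope.
Local Open Scope ring_scope.

(* The norm of the library on ['rV[R]_d] is the sup norm; this is the square
   of the Euclidean one. *)
Definition sqnorm2 (R : realType) (d : nat) (x : 'rV[R]_d) : R :=
  \sum_(i < d) x ord0 i ^+ 2.

Definition weakly_convex_smooth (R : realType) (d : nat) (L mu : R)
    (f : 'rV[R]_d -> R) : Prop :=
  [/\ has_lbound (range f),
      convex_function setT
        (fun x => L / 2 * sqnorm2 x - f x : convex_numDomainType R) &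
      convex_function setT
        (fun x => f x - mu / 2 * sqnorm2 x : convex_numDomainType R)].

(* In a field of MathComp [0^-1 = 0], so the reading of [(1 - t)^(-2k)] as
   [+oo] at [t = 1] has to be put in by hand. *)
Definition inv_even_pow (R : realType) (t : R) (k : nat) : \bar R :=
  if t == 1 then +oo%E else ((1 - t) ^- (2 * k))%:E.

Definition gain (R : realType) (t : R) (k : nat) : \bar R :=
  ((t^-1)%:E * (- 1%:E + inv_even_pow t k))%E.

Definition p (R : realType) (l u : R) : R :=
  2 - (- (l * u)) / (1 - u - `|1 - l|).

(* [fine] only removes the injection of [R] into [\bar R] : for [u < 0 < l],
   [gain u k] is finite and [gain l k] is finite or [+oo], so the positive part
   is a real number. *)
Definition P (R : realType) (N : nat) (l u : R) : R :=
  p l u * (N%:R - (- (l * u)) / (l - u) *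
    \sum_(1 <= k < N.+1) fine (Order.max (gain u k - gain l k) 0)%E).

Definition D (R : realType) (N : nat) (l u : R) : R :=
  1 + l * fine (Order.min (P N l u)%:E (gain l N)).

Definition gd_bound (R : realType) (d : nat) (L mu : R) (f : 'rV[R]_d -> R)
    (x0 : 'rV[R]_d) (N : nat) (gamma : R) : R :=
  (f x0 - inf (range f)) / D N (gamma * L) (gamma * mu).

Definition admissible_step (R : realType) (L gamma : R) : Prop :=
  0 < gamma * L < 2.

(* Uniqueness is only meaningful when the bound depends on the stepsize: it is
   identically [0] if [x0] is a minimizer of [f], and [D 0 = 1]. *)
Definition optimal_step (R : realType) (d : nat) (L mu : R)
    (f : 'rV[R]_d -> R) (x0 : 'rV[R]_d) (N : nat) (gs : R) : Prop :=
  [/\ admissible_step L gs,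
      forall gamma, admissible_step L gamma ->
        gd_bound L mu f x0 N gs <= gd_bound L mu f x0 N gamma &
      (0 < N)%N -> inf (range f) < f x0 ->
      forall gamma, admissible_step L gamma -> gamma != gs ->
        gd_bound L mu f x0 N gs < gd_bound L mu f x0 N gamma].

(* The bound at [gs] is within a factor [1 + o(1)] of the best one, and every
   stepsize outside a given neighbourhood of [gs] is strictly worse than [gs]
   for all large [N]; so the optimal stepsizes for [N] iterations tend to [gs].
   For finite [N] they may differ from [gs]. *)
Definition asymptotically_optimal_step (R : realType) (d : nat) (L mu : R)
    (f : 'rV[R]_d -> R) (x0 : 'rV[R]_d) (gs : R) : Prop :=
  [/\ admissible_step L gs,
      forall e, 0 < e -> \forall N \near \oo,
        forall gamma, admissible_step L gamma ->
          gd_bound L mu f x0 N gs <= (1 + e) * gd_bound L mu f x0 N gamma &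
      inf (range f) < f x0 ->
      forall e, 0 < e -> \forall N \near \oo,
        forall gamma, admissible_step L gamma -> e <= `|gamma - gs| ->
          gd_bound L mu f x0 N gs < gd_bound L mu f x0 N gamma].

Definition kappa_bar (R : realType) : R :=
  (- 9 - 5 * Num.sqrt 5 + Num.sqrt (190 + 90 * Num.sqrt 5)) / 4.

(* The unknown [s] is the normalized stepsize [gamma * L]; the cubic is the
   stationarity condition of [l * p l (kappa * l)] at [l = s], for [1 <= l < 2]. *)
Definition step_equation (R : realType) (kappa s : R) : Prop :=
  1 <= s < 2 /\
  - kappa * (1 + kappa) * s ^+ 3 + (3 * kappa + (1 + kappa) ^+ 2) * s ^+ 2
    - 4 * (1 + kappa) * s + 4 = 0.

(* Main.v *)
Require Import Defs.
From mathcomp Require Import all_boot all_order all_algebra.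
From mathcomp Require Import all_classical all_reals all_analysis.
From mathcomp Require Import ring lra.

Import Order.TTheory GRing.Theory Num.Theory.
Import numFieldNormedType.Exports.

Local Open Scope ring_scope.

Set Implicit Arguments.
Unset Strict Implicit.

(** Write [q = - kappa > 0], [l = gamma L], so that [gamma mu = - q l], and let
    [rate q l = l * p l (- q l)]. Since the sum in [P] is nonnegative,
    [D N l <= 1 + N * rate q l] for every step ([D_bounds]); minimizing the
    bound is maximizing [D N], so a step that maximizes [rate q] is optimal as
    soon as this estimate is an equality there, and it is asymptotically
    optimal as soon as the estimate is sharp up to a constant independent of
    [N].

    On [[1, 2)] the rate is [2 l - q l^3 / (2 - l + q l)], and [x^3 / y] is
    convex on the positive quadrant, so the rate is strictly concave; its
    stationarity condition is the cubic of the step equation, positive at [1]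
    and negative at [2]. On [(0, 1]] the rate is increasing. Keeping the
    explicit second-order remainder of [x^3 / y] gives more than a maximum: a
    root [s] of the cubic satisfies
    [rate q l + c (l - s)^2 <= rate q s] on all of [(0, 2)] for some [c > 0]
    ([rate_quadratic_max]). Uniqueness of the root, strict optimality, and the
    uniform separation needed for large [N] all follow from this inequality.

    The estimate is an equality at [s] when every positive part in the sum
    vanishes and the minimum in [D] is attained by [P]. Bernoulli's inequality
    reduces both conditions, for all [k] and [N], to the case of one iteration,
    and there both are the single inequality
    [q s^2 + 2 (1 - q) s <= 3] ([D_threshold]). At the borderline value of [q]
    this quadratic and the cubic have a common root; eliminating it gives a
    quartic that factors over [Q(sqrt 5)], whence the closed form of
    [kappa_bar] ([threshold_le0]).

    Without the inequality, [s > 1] still makes [(1 - s)^(-2 k)] grow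
    geometrically, so that only finitely many terms of the sum are nonzero and
    the minimum is attained by [P] for large [N]: the estimate is then sharp up
    to a constant ([D_asymptotic]). *)

(** * The linear rate and its stationary point *)

Definition rate (R : realType) (q l : R) : R := l * p l (- (q * l)).

(** Half of [(2 - l + q l)^2] times the derivative of [rate q] on [[1, 2)],
    grouped so that the denominator [2 - l + q l] of the rate is visible. *)
Definition cubic (R : realType) (q l : R) : R :=
  (2 - l + q * l) ^+ 2 - q * l ^+ 2 * (3 - l + q * l).

(** For [1 < l < 2] and [u = - q l], this has the sign of both
    [gain u 1 - gain l 1] and [p l u - gain l 1]. *)
Definition threshold (R : realType) (q l : R) : R :=
  q * l ^+ 2 + 2 * (1 - q) * l - 3.

Lemma step_equationE (R : realType) (q s : R) :
  step_equation (- q) s <-> 1 <= s < 2 /\ cubic q s = 0.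
Proof.
rewrite /step_equation /cubic.
by split=> -[? E]; split=> //; rewrite -[RHS]E; ring.
Qed.

Lemma p_le1 (R : realType) (q l : R) (q0 : 0 < q) :
  0 < l -> l <= 1 -> p l (- (q * l)) = 2 - q * l / (1 + q).
Proof.
move=> l0 l1; rewrite /p ger0_norm; last by lra.
have -> : 1 - - (q * l) - (1 - l) = l * (1 + q) by ring.
by field; rewrite !gt_eqF //; lra.
Qed.

Lemma den_gt0 (R : realType) (q l : R) (q0 : 0 < q) :
  1 <= l -> l < 2 -> 0 < 2 - l + q * l.
Proof. by move=> *; have : 0 < q * l by [apply: mulr_gt0; lra]; lra. Qed.

Lemma p_ge1 (R : realType) (q l : R) (q0 : 0 < q) : 1 <= l -> l < 2 ->
  p l (- (q * l)) = 2 - q * l ^+ 2 / (2 - l + q * l).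
Proof.
move=> l1 l2; rewrite /p ler0_norm; last by lra.
have h := den_gt0 q0 l1 l2.
have -> : 1 - - (q * l) - - (1 - l) = 2 - l + q * l by ring.
by congr (2 - _ / _); ring.
Qed.

Lemma p_gt0 (R : realType) (q l : R) (q0 : 0 < q) :
  0 < l < 2 -> 0 < p l (- (q * l)).
Proof.
move=> /andP[l0 l2]; have [l1|/ltW l1] := leP l 1.
  rewrite (p_le1 q0) // subr_gt0 ltr_pdivrMr; nra.
have m0 := den_gt0 q0 l1 l2.
rewrite (p_ge1 q0) // subr_gt0 ltr_pdivrMr //.
have : 0 < (2 - l) * (2 + q * l).
  by apply: mulr_gt0; [lra|have := mulr_gt0 q0 (lt_le_trans ltr01 l1); lra].
lra.
Qed.

(** The gap is [q] times the error of the tangent to [x^3 / y] along the line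
    [y = 2 - (1 - q) x], the linear part vanishing by stationarity. With
    [n] and [m] the values of [y] at [s] and [l], this error is
    [(l - s)^2 (2 s (n + 2) + l n^2) / (m n^2)]. *)
Lemma rate_gap_ge1 (R : realType) (q s l : R) (q0 : 0 < q) :
  1 <= s -> s < 2 -> 1 <= l -> l < 2 ->
  cubic q s = 0 ->
  2 * q / ((1 + q) * (2 - s + q * s) ^+ 2) * (l - s) ^+ 2
    <= rate q s - rate q l.
Proof.
move=> s1 s2 l1 l2 E; rewrite /rate !(p_ge1 q0) //.
have n0 := den_gt0 q0 s1 s2; have m0 := den_gt0 q0 l1 l2.
set n := 2 - s + q * s in E n0 *; set m := 2 - l + q * l in m0 *.
have -> : s * (2 - q * s ^+ 2 / n) - l * (2 - q * l ^+ 2 / m) =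
    q * (l - s) ^+ 2 * (2 * s * (n + 2) + l * n ^+ 2) / (m * n ^+ 2).
  (* the last term is the derivative of the rate at [s], times [s - l] *)
  transitivity (q * (l - s) ^+ 2 * (2 * s * (n + 2) + l * n ^+ 2) / (m * n ^+ 2)
    - 2 * (l - s) / n ^+ 2 * cubic q s); last by rewrite E; ring.
  rewrite /cubic /n /m; field.
  by rewrite !gt_eqF.
have n2 : 0 < n ^+ 2 by apply: exprn_gt0.
have -> : 2 * q / ((1 + q) * n ^+ 2) * (l - s) ^+ 2 =
  q * (l - s) ^+ 2 * (4 / (2 * (1 + q) * n ^+ 2)).
  by field; rewrite !gt_eqF //; lra.
have mq : m <= 2 * (1 + q) by rewrite /m; nra.
have a0 : 0 <= q * (l - s) ^+ 2 by rewrite mulr_ge0 ?sqr_ge0 ?ltW.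
rewrite -[leRHS]mulrA; apply: ler_wpM2l => //.
(* the constant comes from [m <= 2 * (1 + q)] and [4 <= k] *)
set k := 2 * s * (n + 2) + l * n ^+ 2.
have k4 : 4 <= k.
  have := mulr_ge0 (le_trans ler01 l1) (ltW n2).
  have := mulr_ge0 (le_trans ler01 s1) (ltW n0).
  by rewrite /k; lra.
rewrite ler_pdivrMr; last by apply: mulr_gt0 => //; lra.
rewrite mulrAC ler_pdivlMr; last exact: mulr_gt0.
have : 4 * m <= k * (2 * (1 + q)) by apply: ler_pM => //; lra.
by move/(ler_wpM2r (ltW n2)); lra.
Qed.

(** For [l <= 1] the rate is first compared with its value at [1]; there the
    increase is at least linear in [1 - l], hence quadratic since [1 - l <= 1],
    and the two losses are combined by
    [(l - s)^2 <= 2 (1 - l)^2 + 2 (1 - s)^2]. *)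
Lemma rate_quadratic_max (R : realType) (q s : R) (q0 : 0 < q) :
  1 <= s -> s < 2 -> cubic q s = 0 ->
  exists2 c, 0 < c &
    forall l, 0 < l < 2 -> rate q l + c * (l - s) ^+ 2 <= rate q s.
Proof.
move=> s1 s2 E.
pose c0 := 2 * q / ((1 + q) * (2 - s + q * s) ^+ 2).
have n0 := den_gt0 q0 s1 s2.
have c00 : 0 < c0.
  by apply: divr_gt0; apply: mulr_gt0; rewrite ?exprn_gt0 //; lra.
have c10 : 0 < 2 / (1 + q) by apply: divr_gt0; lra.
pose c := Num.min c0 (2 / (1 + q)) / 2.
have cc0 : 2 * c <= c0 by rewrite /c mulrC divfK ?ge_min ?lexx ?pnatr_eq0.
have cc1 : 2 * c <= 2 / (1 + q).
  by rewrite /c mulrC divfK ?ge_min ?lexx ?orbT ?pnatr_eq0.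
have c_gt0 : 0 < c by rewrite divr_gt0 // lt_min c00.
exists c => // l /andP[l0 l2].
have [l1|/ltW l1] := leP 1 l.
  have := rate_gap_ge1 q0 s1 s2 l1 l2 E; rewrite -/c0.
  have := sqr_ge0 (l - s); nra.
have := rate_gap_ge1 q0 s1 s2 (lexx 1) ltac:(lra) E; rewrite -/c0 => h1.
have r1 : rate q 1 - rate q l = (1 - l) * (2 - q * (1 + l) / (1 + q)).
  rewrite /rate !(p_le1 q0) //.
  by field; rewrite gt_eqF //; lra.
have : 2 / (1 + q) * (1 - l) ^+ 2 <= rate q 1 - rate q l.
  rewrite r1 expr2 mulrA mulrC; apply: ler_wpM2l; first by lra.
  have -> : 2 - q * (1 + l) / (1 + q) = (2 + q * (1 - l)) / (1 + q).
    by field; rewrite gt_eqF //; lra.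
  rewrite mulrAC ler_wpM2r ?invr_ge0; nra.
have : c * (l - s) ^+ 2 <= 2 * c * (1 - l) ^+ 2 + 2 * c * (1 - s) ^+ 2.
  have : 0 <= c * (2 * (1 - l) ^+ 2 + 2 * (1 - s) ^+ 2 - (l - s) ^+ 2).
    apply: mulr_ge0; first exact: ltW.
    by have := sqr_ge0 (2 - l - s); nra.
  lra.
have := ler_wpM2r (sqr_ge0 (1 - l)) cc1.
have := ler_wpM2r (sqr_ge0 (1 - s)) cc0.
lra.
Qed.

(** Two stationary points would each have the strictly larger rate. *)
Lemma cubic_root_unique (R : realType) (q s t : R) (q0 : 0 < q) :
  1 <= s < 2 -> 1 <= t < 2 ->
  cubic q s = 0 -> cubic q t = 0 -> s = t.
Proof.
move=> /andP[s1 s2] /andP[t1 t2] Es Et.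
have [c c0 /(_ t ltac:(lra)) hs] := rate_quadratic_max q0 s1 s2 Es.
have [d d0 /(_ s ltac:(lra)) ht] := rate_quadratic_max q0 t1 t2 Et.
apply/eqP; rewrite -subr_eq0 -sqrf_eq0; apply/eqP.
have : (c + d) * (s - t) ^+ 2 <= 0 by lra.
rewrite pmulr_rle0; last by lra.
by have := sqr_ge0 (s - t); lra.
Qed.

Lemma cubic1 (R : realType) (q : R) : cubic q 1 = 1.
Proof. by rewrite /cubic; ring. Qed.

Lemma cubic_ivt (R : realType) (q b : R) (q0 : 0 < q) :
  1 <= b -> cubic q b <= 0 ->
  exists2 s, 1 <= s <= b & cubic q s = 0.
Proof.
move=> b1 hb.
pose P : {poly R} :=
  (2%:P - 'X + q *: 'X) ^+ 2 - q *: 'X ^+ 2 * (3%:P - 'X + q *: 'X).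
have PE l : P.[l] = cubic q l.
  by rewrite /P /cubic !hornerE; ring.
have [|s sb /rootP] := @poly_ivt R (- P) 1 b b1.
  by rewrite !hornerN !PE cubic1; lra.
by rewrite hornerN PE => E; exists s => //; lra.
Qed.

Lemma cubic_root_exists (R : realType) (q : R) (q0 : 0 < q) :
  exists2 s, 1 <= s < 2 & cubic q s = 0.
Proof.
have h2 : cubic q 2 < 0 by rewrite /cubic; nra.
have [s /andP[s1 s2] E] := @cubic_ivt _ _ 2 q0 ltac:(lra) (ltW h2).
exists s => //; rewrite s1 lt_neqAle s2 andbT.
by apply: contraTneq h2 => <-; rewrite E ltxx.
Qed.

(** A nonpositive value at [t] would give a second root in [[1, t]]. *)
Lemma cubic_gt0 (R : realType) (q s t : R) (q0 : 0 < q) :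
  s < 2 -> cubic q s = 0 -> 1 <= t -> t < s ->
  0 < cubic q t.
Proof.
move=> s2 Es t1 ts; rewrite ltNge; apply/negP => /(cubic_ivt q0 t1)[s' s't Es'].
have := @cubic_root_unique _ _ s s' q0 ltac:(lra) ltac:(lra) Es Es'; lra.
Qed.

(** * The value of kappa below which the estimate is exact *)

Lemma threshold_ivt (R : realType) (q s : R) : 0 < q -> 1 <= s ->
  0 < threshold q s -> exists2 t, 1 <= t < s & threshold q t = 0.
Proof.
move=> q0 s1 hs.
pose P : {poly R} := q *: 'X ^+ 2 + (2 * (1 - q)) *: 'X - 3%:P.
have PE l : P.[l] = threshold q l.
  by rewrite /P /threshold !hornerE; ring.
have [|t /andP[t1 ts] /rootP] := @poly_ivt R P 1 s s1.
  by rewrite !PE (ltW hs) andbT /threshold; lra.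
rewrite PE => E; exists t => //; rewrite t1 lt_neqAle ts andbT.
by apply: contraTneq hs => <-; rewrite E ltxx.
Qed.

(** With [w = t - 1], the vanishing of the threshold reads
    [q (1 - w^2) = 2 w - 1]. Substituting this in the cubic leaves
    [- (w^4 - w^3 + 2 w - 1)] up to a positive factor, and with
    [g = (sqrt 5 - 1) / 2] the quartic is
    [(w^2 + g w - g) (w^2 - (1 + g) w + (1 + g))], the second factor being
    positive. The factor [w^2 + g w - g] also divides
    [(1 - w^2)^2 (q^2 - (9 + 5 sqrt 5) / 2 q + 1)], written in [w]; the last
    polynomial in [q] has the roots [- kappa_bar] and [- 1 / kappa_bar]. *)
Lemma cubic_gt0_lt_kappa_bar (R : realType) (q t : R) : 0 < q -> 1 <= t < 2 ->
  threshold q t = 0 -> 0 < cubic q t -> q < - kappa_bar R.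
Proof.
move=> q0 /andP[t1 t2] C E.
pose r : R := Num.sqrt 5; pose v : R := Num.sqrt (190 + 90 * r).
have r0 : 0 <= r by exact: sqrtr_ge0.
have r5 : r ^+ 2 = 5 by rewrite sqr_sqrtr.
have v0 : 0 <= v by exact: sqrtr_ge0.
have v2 : v ^+ 2 = 190 + 90 * r by rewrite sqr_sqrtr //; lra.
have rl : 2 < r by rewrite ltNge; apply/negP => h; nra.
have ru : r < 23 / 10 by rewrite ltNge; apply/negP => h; nra.
pose g := (r - 1) / 2; pose w := t - 1.
have tw : t = 1 + w by rewrite /w; ring.
have w0 : 0 <= w by rewrite /w; lra.
have w1 : w < 1 by rewrite /w; lra.
have qw : q * (1 - w ^+ 2) = 2 * w - 1.
  by apply/eqP; rewrite -subr_eq0 -oppr_eq0 -C /threshold tw; apply/eqP; ring.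
have quartic : w ^+ 4 - w ^+ 3 + 2 * w - 1 < 0.
  have : 0 < (1 - w) ^+ 2 * cubic q t by rewrite mulr_gt0 ?exprn_gt0 //; lra.
  suff -> : (1 - w) ^+ 2 * cubic q t = - (w ^+ 4 - w ^+ 3 + 2 * w - 1) by lra.
  have M : (2 - t + q * t) * (1 - w) = w ^+ 2.
    rewrite tw; transitivity ((1 - w) ^+ 2 + q * (1 - w ^+ 2)); first by ring.
    by rewrite qw; ring.
  have qt : q * t ^+ 2 * (1 - w) = (1 + w) * (2 * w - 1).
    by rewrite -qw tw; ring.
  transitivity (((2 - t + q * t) * (1 - w)) ^+ 2 - q * t ^+ 2 * (1 - w)
     * ((2 - t + q * t) * (1 - w) + (1 - w))); first by rewrite /cubic; ring.
  by rewrite M qt; ring.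
have neg : w ^+ 2 + g * w - g < 0.
  have pos : 0 < w ^+ 2 - (1 + g) * w + (1 + g).
    by rewrite /g; have := sqr_ge0 (w - (1 + g) / 2); rewrite /g; nra.
  rewrite -(pmulr_llt0 _ pos).
  suff -> : (w ^+ 2 + g * w - g) * (w ^+ 2 - (1 + g) * w + (1 + g))
     = w ^+ 4 - w ^+ 3 + 2 * w - 1 by [].
  transitivity (w ^+ 4 - w ^+ 3 + 2 * w - 1
     + (r ^+ 2 - 5) / 4 * (- w ^+ 2 + 2 * w - 1)); last by rewrite r5; ring.
  by rewrite /g; field.
have w55 : w < 55 / 100.
  by rewrite ltNge; apply/negP => h; move: neg; rewrite /g; nra.
have q1 : q < 1 by rewrite ltNge; apply/negP => h; nra.
have resultant : 0 < q ^+ 2 - (9 + 5 * r) / 2 * q + 1.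
  have d0 : 0 < (1 - w ^+ 2) ^+ 2 by rewrite exprn_gt0 //; nra.
  pose e := (19 + 9 * r) / 2.
  rewrite -(pmulr_lgt0 _ d0).
  have -> : (q ^+ 2 - (9 + 5 * r) / 2 * q + 1) * (1 - w ^+ 2) ^+ 2 =
    (w ^+ 2 + g * w - g) * (w ^+ 2 + e * w - e).
    transitivity ((q * (1 - w ^+ 2)) ^+ 2 - (9 + 5 * r) / 2
      * (q * (1 - w ^+ 2)) * (1 - w ^+ 2) + (1 - w ^+ 2) ^+ 2); first by ring.
    rewrite qw.
    transitivity ((w ^+ 2 + g * w - g) * (w ^+ 2 + e * w - e)
      - (r ^+ 2 - 5) * (9 / 4) * (1 - w) ^+ 2); last by rewrite r5; ring.
    by rewrite /g /e; field.
  by rewrite nmulr_rgt0 // /e; nra.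
rewrite /kappa_bar -/r -/v ltNge; apply/negP => h.
(* [- kappa_bar] and its inverse are the roots of the quadratic in
   [resultant], and [q < 1] lies below the larger one *)
have : 0 <= (q - (9 + 5 * r - v) / 4) * ((9 + 5 * r + v) / 4 - q).
  by apply: mulr_ge0; lra.
nra.
Qed.

(** If the threshold were positive at [s], it would vanish at some [t < s],
    where the cubic is still positive. *)
Lemma threshold_le0 (R : realType) (q s : R) : 0 < q -> 1 <= s < 2 ->
  cubic q s = 0 -> - kappa_bar R <= q -> threshold q s <= 0.
Proof.
move=> q0 /andP[s1 s2] Es hq; rewrite leNgt; apply/negP.
move=> /(threshold_ivt q0 s1)[t /andP[t1 ts] Et].
have t2 : 1 <= t < 2 by lra.
have := cubic_gt0_lt_kappa_bar q0 t2 Et (cubic_gt0 q0 s2 Es t1 ts).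
lra.
Qed.

(** * Bounds on the performance denominator *)

Lemma bernoulli_exp (R : realType) (x : R) (k : nat) : 0 <= x ->
  1 + k%:R * (x - 1) <= x ^+ k.
Proof.
move=> x0; elim: k => [|k IH]; first by rewrite expr0; lra.
rewrite exprS -natr1.
have := ler_wpM2l x0 IH.
have := mulr_ge0 (ler0n R k) (sqr_ge0 (x - 1)).
lra.
Qed.

Lemma gainE (R : realType) (t : R) (k : nat) : t != 1 ->
  gain t k = ((((1 - t) ^+ 2)^-1 ^+ k - 1) / t)%:E.
Proof.
move=> /negbTE t1; rewrite /gain /inv_even_pow t1 -EFinN -EFinD -EFinM.
by rewrite exprVn exprM mulrC addrC.
Qed.

Lemma gain_ge0 (R : realType) (t : R) (k : nat) :
  0 < t < 2 -> (0 <= gain t k)%E.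
Proof.
move=> /andP[t0 t2]; have [->|t1] := eqVneq t 1.
  by rewrite /gain /inv_even_pow eqxx invr1 mul1e /= leey.
rewrite gainE // lee_fin divr_ge0 ?(ltW t0) // subr_ge0 exprn_ege1 //.
have d0 : 0 < (1 - t) ^+ 2 by rewrite exprn_even_gt0 //= subr_eq0 eq_sym.
by rewrite invf_ge1 //; nra.
Qed.

Lemma gain_neg (R : realType) (y : R) (k : nat) : 0 < y ->
  gain (- y) k = ((1 - ((1 + y) ^+ 2)^-1 ^+ k) / y)%:E.
Proof.
move=> y0; rewrite gainE; last by rewrite lt_eqF //; lra.
by rewrite opprK invrN mulrN -mulNr opprB.
Qed.

Definition shortfall (R : realType) (l u : R) (k : nat) : R :=
  fine (Order.max (gain u k - gain l k) 0)%E.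

Lemma shortfall_ge0 (R : realType) (l u : R) (k : nat) : 0 <= shortfall l u k.
Proof. by rewrite fine_ge0 // le_max lexx orbT. Qed.

(** The gain at [- y] is at most its limit [y^-1] as [k] grows, and the gain at
    [l] is nonnegative. *)
Lemma shortfall_le (R : realType) (l y : R) (k : nat) : 0 < l < 2 -> 0 < y ->
  shortfall l (- y) k <= y^-1.
Proof.
move=> hl y0; rewrite /shortfall gain_neg //.
have := gain_ge0 k hl.
set a := (1 - _) / y.
have a0 : a <= y^-1.
  rewrite /a ler_pdivrMr // mulVf ?gt_eqF // gerBl exprn_ge0 //.
  by rewrite invr_ge0 sqr_ge0.
have v0 : 0 <= y^-1 by rewrite invr_ge0 ltW.
case: (gain l k) => [b| |] //=; last by rewrite max_r ?leNye /=.
rewrite lee_fin => b0; rewrite -EFinB -EFin_max /= ge_max v0 andbT; lra.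
Qed.

Lemma shortfall_eq0 (R : realType) (l u : R) (k : nat) :
  (gain u k <= gain l k)%E -> gain u k \is a fin_num -> shortfall l u k = 0.
Proof.
by move=> le_ul fin_u; rewrite /shortfall max_r // sube_le0.
Qed.

(** Each term of the sum is at most [(q l)^-1], which the prefactor
    [q l / (1 + q)] turns into at most [(1 + q)^-1], so that the bracket in [P]
    stays nonnegative. *)
Lemma P_bounds (R : realType) (N : nat) (q l : R) : 0 < q -> 0 < l < 2 ->
  0 <= P N l (- (q * l)) <= p l (- (q * l)) * N%:R.
Proof.
move=> q0 hl; have [l0 _] := andP hl.
have p0 := ltW (p_gt0 q0 hl); rewrite /P.
set c := - (l * _) / _; set S := \sum_(_ <= _ < _) _.
have cE : c = q * l / (1 + q) by rewrite /c; field; rewrite !gt_eqF //; nra.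
have c0 : 0 <= c by rewrite cE divr_ge0 //; nra.
have S0 : 0 <= S by apply: sumr_ge0 => k _; exact: shortfall_ge0.
have SN : S <= N%:R * (q * l)^-1.
  apply: (@le_trans _ _ (\sum_(1 <= k < N.+1) (q * l)^-1)).
    by apply: ler_sum => k _; exact: shortfall_le k hl (mulr_gt0 q0 l0).
  by rewrite sumr_const_nat subn1 /= mulr_natl.
have cS : c * S <= N%:R.
  apply: (le_trans (ler_wpM2l c0 SN)).
  have -> : c * (N%:R * (q * l)^-1) = N%:R / (1 + q).
    by rewrite cE; field; rewrite !gt_eqF //; lra.
  by rewrite ler_pdivrMr; have := ler0n R N; nra.
rewrite mulr_ge0 //=; last by lra.
by apply: ler_wpM2l => //; rewrite gerBl mulr_ge0.
Qed.

Lemma D_bounds (R : realType) (N : nat) (q l : R) : 0 < q -> 0 < l < 2 ->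
  1 <= D N l (- (q * l)) <= 1 + N%:R * rate q l.
Proof.
move=> q0 hl; have [l0 _] := andP hl.
have [P0 PN] := andP (P_bounds N q0 hl).
have m0 : (0 <= Order.min (P N l (- (q * l)))%:E (gain l N))%E.
  by rewrite le_min lee_fin P0 gain_ge0.
rewrite /D /rate; apply/andP; split.
  by rewrite lerDl mulr_ge0 ?fine_ge0 // ltW.
rewrite lerD2l mulrCA mulrA -mulrA; apply: ler_wpM2l; first exact: ltW.
rewrite (mulrC N%:R); apply: le_trans PN; rewrite -lee_fin fineK.
  by rewrite ge_min lexx.
by rewrite ge0_fin_numE // gt_min ltry.
Qed.

Lemma D_min (R : realType) (N : nat) (s u : R) : 0 < s -> s != 1 ->
  D N s u = 1 + Num.min (s * P N s u) (((1 - s) ^+ 2)^-1 ^+ N - 1).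
Proof.
move=> s0 s1; rewrite /D gainE // -EFin_min /= minr_pMr ?ltW //.
by rewrite [in s * (_ / s)]mulrC divfK // gt_eqF.
Qed.

(** With [y = q s], the two conditions for one iteration are
    [(2 + y) (s - 1)^2 <= (2 - s) (1 + y)^2] (no positive part) and
    [(2 + y) (s - 1)^2 <= 2 - s + y] (the minimum is attained by [P]). The
    differences of their sides are [- threshold q s] times [s + y] and times [s]
    respectively. *)
Lemma D_threshold (R : realType) (N : nat) (q s : R) : 0 < q -> 1 < s < 2 ->
  threshold q s <= 0 -> D N s (- (q * s)) = 1 + N%:R * rate q s.
Proof.
move=> q0 /andP[s1 s2] C; have s0 : 0 < s by lra.
have ns1 : s != 1 by rewrite gt_eqF.
rewrite D_min //; set a := (1 - s) ^+ 2.
have y0 : 0 < q * s by exact: mulr_gt0.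
set y := q * s in y0 *.
have a0 : 0 < a by rewrite exprn_even_gt0 //= subr_eq0 eq_sym.
have b0 : 0 < (1 + y) ^+ 2 by rewrite exprn_gt0 //; lra.
have Cy : y * s + 2 * s - 2 * y - 3 <= 0 by move: C; rewrite /threshold /y; lra.
have d1 : 1 - s != 0 by rewrite subr_eq0 eq_sym.
have sn0 : s != 0 by rewrite gt_eqF.
have gain1 : (1 - ((1 + y) ^+ 2)^-1) / y <= (a^-1 - 1) / s.
  have -> : (1 - ((1 + y) ^+ 2)^-1) / y = (2 + y) / (1 + y) ^+ 2.
    by field; rewrite !gt_eqF //; lra.
  have -> : (a^-1 - 1) / s = (2 - s) / a.
    by rewrite /a; field; rewrite d1 sn0.
  rewrite ler_pdivrMr // mulrAC ler_pdivlMr //.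
  have : 0 <= - (y * s + 2 * s - 2 * y - 3) * (s + y) by apply: mulr_ge0; lra.
  by rewrite /a; lra.
have rate1 : rate q s <= a^-1 - 1.
  have m0 : 0 < 2 - s + y by lra.
  have -> : rate q s = s * (2 - s) * (2 + y) / (2 - s + y).
    by rewrite /rate (p_ge1 q0) ?ltW // -/y; rewrite /y; field; rewrite gt_eqF.
  have -> : a^-1 - 1 = s * (2 - s) / a.
    by rewrite /a; field; rewrite d1.
  rewrite ler_pdivrMr // [leRHS]mulrAC ler_pdivlMr //.
  rewrite -!mulrA; do 2 (apply: ler_wpM2l; first by lra).
  have : 0 <= - (y * s + 2 * s - 2 * y - 3) * s by apply: mulr_ge0; lra.
  by rewrite /a; lra.
have w0 : 0 <= a^-1 by rewrite invr_ge0 ltW.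
have r0 : 0 <= ((1 + y) ^+ 2)^-1 by rewrite invr_ge0 ltW.
have PE : P N s (- y) = p s (- y) * N%:R.
  rewrite /P big1 ?mulr0 ?subr0 // => k _.
  apply: shortfall_eq0; rewrite gain_neg // gainE // lee_fin -/a.
  apply: (@le_trans _ _ (k%:R * ((1 - ((1 + y) ^+ 2)^-1) / y))).
    rewrite mulrA; apply: ler_wpM2r; first by rewrite invr_ge0 ltW.
    by have := bernoulli_exp k r0; lra.
  apply: (@le_trans _ _ (k%:R * ((a^-1 - 1) / s))); first exact: ler_wpM2l.
  rewrite mulrA; apply: ler_wpM2r; first by rewrite invr_ge0 ltW.
  by have := bernoulli_exp k w0; lra.
rewrite PE mulrA (_ : s * p s (- y) = rate q s) // [_ * N%:R]mulrC min_l //.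
have := ler_wpM2l (ler0n R N) rate1.
by have := bernoulli_exp N w0; lra.
Qed.

(** The gain at [s] grows at least linearly in [k] by Bernoulli, while the gain
    at [- q s] stays below [(q s)^-1]. *)
Lemma sum_shortfall_bounded (R : realType) (q s : R) : 0 < q -> 1 < s < 2 ->
  exists B : R, forall N,
    \sum_(1 <= k < N.+1) shortfall s (- (q * s)) k <= B.
Proof.
move=> q0 /andP[s1 s2]; have s0 : 0 < s by lra.
have y0 : 0 < q * s by exact: mulr_gt0.
set y := q * s in y0 *; set a := (1 - s) ^+ 2.
have ns1 : s != 1 by rewrite gt_eqF.
have a0 : 0 < a by rewrite exprn_even_gt0 //= subr_eq0 eq_sym.
have a1 : 0 < a^-1 - 1.
  by rewrite subr_gt0 invf_gt1 // /a; nra.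
have v0 : 0 <= y^-1 by rewrite invr_ge0 ltW.
pose k0 := Num.bound (s * y^-1 / (a^-1 - 1)).
have late k : (k0 <= k)%N -> shortfall s (- y) k = 0.
  move=> k0k; apply: shortfall_eq0; rewrite gain_neg // gainE // lee_fin -/a.
  apply: (@le_trans _ _ y^-1).
    rewrite ler_pdivrMr // mulVf ?gt_eqF // gerBl exprn_ge0 //.
    by rewrite invr_ge0 sqr_ge0.
  rewrite ler_pdivlMr // mulrC.
  have : s * y^-1 / (a^-1 - 1) <= k%:R.
    apply: (@le_trans _ _ k0%:R); last by rewrite ler_nat.
    apply/ltW/archi_boundP; apply: divr_ge0; last exact: ltW.
    by apply: mulr_ge0 => //; exact: ltW.
  rewrite ler_pdivrMr // => h.
  have w0 : 0 <= a^-1 by rewrite invr_ge0 ltW.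
  by have := bernoulli_exp k w0; lra.
exists (y^-1 * k0%:R) => N.
suff : \sum_(1 <= k < N.+1) shortfall s (- y) k <= y^-1 * (minn N k0)%:R.
  by move/le_trans; apply; rewrite ler_wpM2l // ler_nat geq_minr.
elim: N => [|N IH]; first by rewrite big_nil min0n mulr0.
rewrite big_nat_recr //=; have [Nk|kN] := ltnP N k0.
  move: IH; rewrite (minn_idPl (ltnW Nk)) (minn_idPl Nk) -natr1 => IH.
  have sb : 0 < s < 2 by rewrite s0.
  by have := shortfall_le N.+1 sb y0; lra.
rewrite late ?addr0; last exact: leqW.
by move: IH; rewrite (minn_idPr kN) (minn_idPr (leqW kN)).
Qed.

(** For [P] to attain the minimum, [((s - 1)^-1)^(2 N)] has to outgrow a linear
    function of [N]; Bernoulli's inequality for [(s - 1)^-1], squared, gives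
    quadratic growth. *)
Lemma D_asymptotic (R : realType) (q s : R) : 0 < q -> 1 < s < 2 ->
  exists B : R, exists N0 : nat, forall N, (N0 <= N)%N ->
    1 + N%:R * rate q s - B <= D N s (- (q * s)).
Proof.
move=> q0 hs; have [s1 s2] := andP hs; have s0 : 0 < s by lra.
have ns1 : s != 1 by rewrite gt_eqF.
have [B HB] := sum_shortfall_bounded q0 hs.
have hs0 : 0 < s < 2 by rewrite s0.
have h0 : 0 < rate q s by rewrite mulr_gt0 ?p_gt0.
set c := - (s * - (q * s)) / (s - - (q * s)).
have c0 : 0 <= c.
  by have := mulr_gt0 q0 s0; rewrite /c => ?; rewrite divr_ge0 //; nra.
pose b : R := (s - 1)^-1.
have b1 : 0 < b - 1 by rewrite subr_gt0 invf_gt1; lra.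
exists (rate q s * (c * B)); exists (Num.bound (rate q s / (b - 1) ^+ 2)).
move=> N hN; rewrite D_min // -addrA lerD2l le_min.
have cB : 0 <= c * B.
  apply: mulr_ge0 => //; by apply: le_trans (HB 0%N); rewrite big_nil.
apply/andP; split.
  rewrite /P -/c mulrA -/(rate q s) mulrBr [_ * N%:R]mulrC lerB //.
  by apply: ler_wpM2l; [exact: ltW|exact: (ler_wpM2l c0 (HB N))].
have -> : ((1 - s) ^+ 2)^-1 ^+ N = (b ^+ N) ^+ 2.
  by rewrite -exprM mulnC exprM /b -(sqrrN (1 - s)) opprB !exprVn.
have hb : 1 + N%:R * (b - 1) <= b ^+ N by apply: bernoulli_exp; lra.
have n0 := ler0n R N.
have hN' : rate q s <= N%:R * (b - 1) ^+ 2.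
  rewrite -ler_pdivrMr ?exprn_gt0 //.
  apply: (@le_trans _ _ (Num.bound (rate q s / (b - 1) ^+ 2))%:R).
    apply/ltW/archi_boundP; apply: divr_ge0; last exact: sqr_ge0.
    exact: ltW.
  by rewrite ler_nat.
have nb := mulr_ge0 n0 (ltW b1).
have h2 : (1 + N%:R * (b - 1)) ^+ 2 <= (b ^+ N) ^+ 2.
  by rewrite ler_sqr ?nnegrE //; lra.
have := ler_wpM2l n0 hN'.
have := mulr_ge0 (ltW h0) cB.
lra.
Qed.

(** * Optimality of the stationary step *)

Lemma bound_le (R : realType) (a x y : R) : 0 <= a -> 0 < x -> x <= y ->
  a / y <= a / x.
Proof.
move=> a0 x0 xy; apply: ler_wpM2l => //.
by rewrite lef_pV2 ?posrE // (lt_le_trans x0).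
Qed.

Lemma bound_lt (R : realType) (a x y : R) : 0 < a -> 0 < x -> x < y ->
  a / y < a / x.
Proof.
by move=> a0 x0 xy; rewrite ltr_pM2l // ltf_pV2 ?posrE // (lt_trans x0).
Qed.

Unset Implicit Arguments.

Theorem proposition2p15 (R : realType) (kappa : R) (hkappa : kappa < 0) :
  (exists! s : R, step_equation kappa s) /\
  (forall s : R, step_equation kappa s ->
   forall (d : nat) (L mu : R) (f : 'rV[R]_d -> R) (x0 : 'rV[R]_d),
     0 < L -> mu < 0 -> kappa = mu / L -> weakly_convex_smooth L mu f ->
     (kappa <= kappa_bar R ->
        forall N : nat, optimal_step L mu f x0 N (s / L)) /\
     (kappa_bar R < kappa ->
        asymptotically_optimal_step L mu f x0 (s / L))).
Proof.
pose q := - kappa; have kq : kappa = - q by rewrite opprK.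
have q0 : 0 < q by rewrite oppr_gt0.
rewrite kq; split.
  have [s hs Es] := cubic_root_exists q0.
  exists s; split=> [|t /step_equationE[ht Et]]; first exact/step_equationE.
  exact: (cubic_root_unique q0).
move=> s /step_equationE[hs Es] d L mu f x0 L0 _ muE [flb _ _].
have [s1 s2] := andP hs.
have s_gt1 : 1 < s.
  rewrite lt_neqAle s1 andbT; apply/eqP => s1E.
  by move/eqP: Es; rewrite -s1E cubic1 oner_eq0.
have s0 : 0 < s by lra.
have Lne : L != 0 by rewrite gt_eqF.
have sL : s / L * L = s by rewrite divfK.
have adm : admissible_step L (s / L) by rewrite /admissible_step sL s0.
have boundE N gamma : gd_bound L mu f x0 N gamma =
    (f x0 - inf (range f)) / D N (gamma * L) (- (q * (gamma * L))).
  by rewrite /gd_bound -mulNr muE mulrCA divfK.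
have gap0 : 0 <= f x0 - inf (range f).
  by rewrite subr_ge0; apply: (ge_inf flb); exists x0.
have [c c0 hc] := rate_quadratic_max q0 s1 s2 Es.
have D1 N l : 0 < l < 2 -> 0 < D N l (- (q * l)).
  by move=> /(D_bounds N q0)/andP[h _]; lra.
have hs0 : 0 < s < 2 by rewrite s0.
have DN N l : 0 < l < 2 ->
    D N l (- (q * l)) <= 1 + N%:R * (rate q s - c * (l - s) ^+ 2).
  move=> hl; have [_ h] := andP (D_bounds N q0 hl).
  apply: (le_trans h); rewrite lerD2l; apply: ler_wpM2l => //.
  by have := hc l hl; lra.
split=> hk.
  have Ds N : D N s (- (q * s)) = 1 + N%:R * rate q s.
    apply: D_threshold => //; first by rewrite s_gt1.
    by apply: threshold_le0 => //; lra.
  move=> N; split=> //.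
    move=> gamma hg; rewrite !boundE sL; apply: bound_le => //; first exact: D1.
    apply: (le_trans (DN N _ hg)); rewrite Ds lerD2l ler_wpM2l //.
    by rewrite gerBl mulr_ge0 ?sqr_ge0 // ltW.
  move=> N0 gap gamma hg ne; rewrite !boundE sL.
  apply: bound_lt; [by rewrite subr_gt0|exact: D1|].
  apply: (le_lt_trans (DN N _ hg)); rewrite Ds ltrD2l ltr_pM2l ?ltr0n //.
  rewrite ltrBlDr ltrDl mulr_gt0 // exprn_even_gt0 //= subr_eq0.
  by apply: contra ne => /eqP <-; rewrite mulfK.
have s12 : 1 < s < 2 by rewrite s_gt1.
have [B [N0 HB]] := D_asymptotic q0 s12.
have h0 : 0 < rate q s by rewrite mulr_gt0 ?(p_gt0 q0).
split=> //.
  move=> e e0; near=> N => gamma hg; rewrite !boundE sL.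
  have Dg := D1 N _ hg; have Ds := D1 N _ hs0.
  rewrite mulrCA; apply: ler_wpM2l => //.
  rewrite -[X in _ <= X]invrK invfM invrK lef_pV2 ?posrE //; last first.
    by rewrite mulr_gt0 ?invr_gt0 //; lra.
  rewrite mulrC ler_pdivrMr; last by lra.
  have NN : (N0 <= N)%N by near: N; exact: nbhs_infty_ge.
  (* [N] is so large that [e * (1 + N * rate q s)] absorbs the constant [B] *)
  have NB : (1 + e) * B / (e * rate q s) <= N%:R.
    by near: N; exact: nbhs_infty_ger.
  rewrite ler_pdivrMr in NB; last exact: mulr_gt0.
  have := DN N _ hg; have := HB N NN.
  move/(ler_wpM2r (_ : 0 <= 1 + e)) => /(_ ltac:(lra)).
  have := mulr_ge0 (ler0n R N) (mulr_ge0 (ltW c0) (sqr_ge0 (gamma * L - s))).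
  lra.
move=> gap e e0; near=> N => gamma hg he; rewrite !boundE sL.
apply: bound_lt; [by rewrite subr_gt0|exact: D1|].
have NN : (N0 <= N)%N by near: N; exact: nbhs_infty_ge.
have del0 : 0 < c * (e * L) ^+ 2 by rewrite mulr_gt0 // exprn_gt0 // mulr_gt0.
(* the quadratic loss at distance [e] exceeds [B] after [N] iterations *)
have NB : (B + 1) / (c * (e * L) ^+ 2) <= N%:R.
  by near: N; exact: nbhs_infty_ger.
rewrite ler_pdivrMr // in NB.
have far : c * (e * L) ^+ 2 <= c * (gamma * L - s) ^+ 2.
  apply: ler_wpM2l; first exact: ltW.
  rewrite -[in leRHS]sL -mulrBl -[leRHS]real_normK ?num_real //.
  rewrite normrM (gtr0_norm L0) ler_sqr ?nnegrE ?mulr_ge0 ?normr_ge0 //;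
    rewrite ?ler_wpM2r //; exact: ltW.
have := ler_wpM2l (ler0n R N) far.
have := DN N _ hg; have := HB N NN.
lra.
Unshelve. all: by end_near.
Qed.
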